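(* Let $V_1,\ldots,V_n$ be pairwise disjoint finite sets with $|V_i|\ge 2$ for all $i$. The number of edge sets $E$ such that $(V_1,\ldots,V_n,E)$ is an octahedral system equals $2^{\prod_{i=1}^n|V_i|-\prod_{i=1}^n(|V_i|-1)}$.
   Context: An $n$-uniform hypergraph is $n$-partite if its vertex set is the disjoint union of $n$ sets $V_1,\ldots,V_n$ and each edge meets each $V_i$ in exactly one vertex; it is written $(V_1,\ldots,V_n,E)$. An octahedral system is such a hypergraph with $|V_i|\ge 2$ for all $i$ satisfying the parity condition: for every $X\subseteq\bigcup_i V_i$ with $|X\cap V_i|=2$ for all $i$, the number of edges contained in $X$ is even. Octahedral systems differing by their edge sets are counted as distinct (no identification up to isomorphism). *)

(* Defs.v *)
From mathcomp Require Import all_boot.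

Set Implicit Arguments.
Unset Strict Implicit.
Unset Printing Implicit Defensive.

Section OctahedralSystems.
Variables (T : finType) (n : nat).
Implicit Types (V : 'I_n -> {set T}) (E : {set {set T}}) (X : {set T}).

Definition pairwise_disjoint V : bool :=
  [forall i, forall j, (i != j) ==> [disjoint V i & V j]].

(* Only this union is the vertex set: T may contain points outside it. *)
Definition vertices V : {set T} := \bigcup_(i < n) V i.

Definition uniform_hypergraph (W : {set T}) E : bool :=
  [forall e in E, (e \subset W) && (#|e| == n)].

Definition npartite_hypergraph V E : bool :=
  [&& uniform_hypergraph (vertices V) E,
      pairwise_disjoint V
    & [forall e in E, forall i, #|e :&: V i| == 1]].

Definition parity_condition V E : bool :=
  [forall X : {set T},
     (X \subset vertices V) && [forall i, #|X :&: V i| == 2] ==>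
     ~~ odd #|[set e in E | e \subset X]|].

Definition octahedral_system V E : bool :=
  [&& npartite_hypergraph V E,
      [forall i, 2 <= #|V i|]
    & parity_condition V E].

End OctahedralSystems.

(* Main.v *)
(** Identify an edge with the choice function picking its vertex in each [V i],
    and fix a base point [a].  Over F_2, the parity sum of the box spanned by
    [b] and [c] is the sum, over the vertices [d] of that box, of the parity
    sums of the boxes spanned by [d] and [a]: every point with some coordinate
    taken from [a] is counted an even number of times.  Hence only boxes
    containing [a] matter, and such a condition determines the membership of
    the point opposite to [a] from the membership of points sharing a
    coordinate with [a].  The latter can be prescribed arbitrarily, and there
    are [\prod_i #|V i| - \prod_i (#|V i| - 1)] of them. *)
Require Import Defs.
From mathcomp Require Import all_boot.

Set Implicit Arguments.
Unset Strict Implicit.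
Unset Printing Implicit Defensive.

(** * Sums over F_2 indexed by sets *)

Lemma odd_card_addb (T : finType) (A P : {set T}) :
  odd #|[set x in A | x \in P]| = \big[addb/false]_(x in P) (x \in A).
Proof.
rewrite -sum1_card (big_morph odd oddD (erefl : odd 0 = false)) [LHS]big_mkcond [RHS]big_mkcond.
by apply: eq_bigr => x _; rewrite inE; case: (x \in A); case: (x \in P).
Qed.

(** The subsets pair off as [i |: S] and [S :\ i], and equal terms cancel modulo 2. *)
Lemma big_addb_toggle (I : finType) (i : I) (f : {set I} -> bool) :
  (forall S, f (i |: S) = f (S :\ i)) -> \big[addb/false]_S f S = false.
Proof.
move=> f_toggle; rewrite (bigID (fun S : {set I} => i \in S)) /=.
rewrite (reindex_onto (fun S : {set I} => i |: S) (fun S => S :\ i)) /=; last first.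
  by move=> S; apply: setD1K.
rewrite [X in X (+) _](_ : _ = \big[addb/false]_(S : {set I} | i \notin S) f S) ?addbb //.
apply: eq_big => [S | S /andP[_ /eqP SE]]; last first.
  by rewrite f_toggle -{1}SE setDDl setUid SE.
rewrite setU11 /=; apply/eqP/idP => [<- | /setU1K //].
by rewrite setD11.
Qed.

(** * Parity sums over boxes of points *)

Section Boxes.
Variables (I T : finType).
Local Notation point := {ffun I -> T}.
Implicit Types (a b c p : point) (V : I -> {set T}) (G H : {set point}).

Definition points V : {set point} := [set p : point | [forall i, p i \in V i]].

Definition mix (S : {set I}) b c : point :=
  [ffun i => if i \in S then b i else c i].

(** Indexing by coordinate sets, not by points, counts the vertices of a degenerate box with
    multiplicity, so that its sum cancels. *)
Definition box_sum G b c : bool := \big[addb/false]_(S : {set I}) (mix S b c \in G).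

Lemma pointsP V p : reflect (forall i, p i \in V i) (p \in points V).
Proof. by rewrite inE; apply: forallP. Qed.

Lemma card_points V : #|points V| = \prod_i #|V i|.
Proof.
have -> : #|points V| = #|family (fun i => mem (V i))|.
  by apply: eq_card => p; rewrite inE.
by rewrite card_family foldrE big_map enumT; apply: eq_bigr.
Qed.

Lemma mix_points V S b c : b \in points V -> c \in points V -> mix S b c \in points V.
Proof.
by move=> /pointsP Vb /pointsP Vc; apply/pointsP=> i; rewrite ffunE; case: ifP.
Qed.

Lemma mixT b c : mix setT b c = b.
Proof. by apply/ffunP=> i; rewrite ffunE inE. Qed.

Lemma box_sum_degenerate G b c i : b i = c i -> box_sum G b c = false.
Proof.
move=> bci; apply: (@big_addb_toggle _ i) => S; congr (_ \in G).
apply/ffunP=> j; rewrite !ffunE !inE.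
by have [-> | //] := eqVneq j i; rewrite /= bci.
Qed.

Lemma box_sum_cocycle G a b c :
  box_sum G b c = \big[addb/false]_(S : {set I}) box_sum G (mix S b c) a.
Proof.
(* The outer index [R] now selects the coordinates not taken from [a]. [R = setT] yields the box of
   [b] and [c]; if [R] misses [i], toggling [i] in [S] changes nothing. *)
rewrite exchange_big (bigD1 setT) //= [X in _ (+) X]big1 ?addbF.
  by apply: eq_bigr => S _; rewrite mixT.
move=> R; rewrite -subTset => /subsetPn[i _ Ri].
apply: (@big_addb_toggle _ i) => S; congr (_ \in G).
apply/ffunP=> j; rewrite !ffunE !inE.
by have [-> | //] := eqVneq j i; rewrite (negPf Ri).
Qed.

Lemma box_sumU G H b c : [disjoint G & H] ->
  box_sum (G :|: H) b c = box_sum G b c (+) box_sum H b c.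
Proof.
move=> dGH; rewrite -big_split; apply: eq_bigr => S _; rewrite inE.
by case: (boolP (_ \in G)) => //= /(disjointFr dGH) ->.
Qed.

(** When [b] and [c] differ everywhere, a vertex [p] of their box determines its index as the set of
    [i] with [p i = b i], so no vertex is repeated. *)
Lemma box_sum_odd_card G b c : (forall i, b i != c i) ->
  box_sum G b c = odd #|[set p in G | p \in points (fun i => [set b i; c i])]|.
Proof.
move=> bc; rewrite odd_card_addb.
rewrite (reindex_onto (fun S => mix S b c) (fun p => [set i | p i == b i])) /=.
  apply: eq_bigl => S; apply/esym/andP; split.
    by apply/pointsP=> i; rewrite ffunE !inE; case: ifP; rewrite eqxx ?orbT.
  apply/eqP/setP=> i; rewrite inE ffunE; case: ifP; rewrite ?eqxx //.
  by rewrite eq_sym (negPf (bc i)).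
move=> p /pointsP pbc; apply/ffunP=> i; rewrite ffunE inE.
by case: eqP => [-> // |/eqP p'b]; move: (pbc i); rewrite !inE (negPf p'b) => /eqP.
Qed.

Definition even_on V G : bool :=
  [forall b in points V, forall c in points V, ~~ box_sum G b c].

Lemma even_onP V G :
  reflect {in points V &, forall b c, box_sum G b c = false} (even_on V G).
Proof.
apply: (iffP forall_inP) => [evG b c Vb Vc | evG b Vb].
  by have /forall_inP/(_ c Vc)/negbTE := evG b Vb.
by apply/forall_inP=> c Vc; rewrite evG.
Qed.

(** * Counting even sets of points from a base point *)

Section BasePoint.
Variables (V : I -> {set T}) (a : point).
Hypothesis Va : a \in points V.

Definition opposite : {set point} := points (fun i => V i :\ a i).
Definition adjacent : {set point} := points V :\: opposite.

Lemma opposite_sub : opposite \subset points V.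
Proof.
by apply/subsetP=> p /pointsP Op; apply/pointsP=> i; have /setD1P[] := Op i.
Qed.

Lemma disjoint_adjacent : [disjoint adjacent & opposite].
Proof. by rewrite disjoint_sym disjoints_subset setCD subsetUr. Qed.

Lemma not_opposite p : p \in points V -> p \notin opposite -> exists i, p i = a i.
Proof.
move=> /pointsP Vp; rewrite inE negb_forall => /existsP[i].
by rewrite !inE Vp andbT negbK => /eqP; exists i.
Qed.

Lemma even_on_base G :
  {in opposite, forall b, box_sum G b a = false} -> even_on V G.
Proof.
move=> evG; apply/even_onP=> b c Vb Vc.
rewrite (box_sum_cocycle G a) big1 // => S _.
have Vd := mix_points S Vb Vc; have [/evG // | Od] := boolP (mix S b c \in opposite).
by have [i] := not_opposite Vd Od; apply: box_sum_degenerate.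
Qed.

(** Every index other than [setT] takes some coordinate from [a], which puts the vertex outside
    [opposite]; only the term of [b] survives. *)
Lemma box_sum_opposite H b : H \subset opposite -> box_sum H b a = (b \in H).
Proof.
move=> sHO; rewrite /box_sum (bigD1 setT) //= mixT big1 ?addbF // => S.
rewrite -subTset => /subsetPn[i _ Si]; apply/negbTE/negP=> /(subsetP sHO).
by move/pointsP/(_ i); rewrite ffunE (negPf Si) !inE eqxx.
Qed.

(** An opposite point is added exactly when it is needed to repair the parity of its box with [a];
    the repairs do not interfere, by [box_sum_opposite]. *)
Definition even_extension G : {set point} :=
  G :|: [set b in opposite | box_sum G b a].

Lemma even_extension_even G : G \subset adjacent -> even_on V (even_extension G).
Proof.
move=> sGA; apply: even_on_base => b Ob; rewrite box_sumU.
  rewrite [X in _ (+) X]box_sum_opposite; first by rewrite in_set Ob addbb.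
  by apply/subsetP=> p; rewrite inE => /andP[].
apply: (disjointW sGA _ disjoint_adjacent).
by apply/subsetP=> p; rewrite inE => /andP[].
Qed.

Lemma even_extension_adjacent G :
  G \subset adjacent -> even_extension G :&: adjacent = G.
Proof.
move=> sGA; apply/setP=> p; rewrite in_setI in_setU in_setD [p \in finset _]in_set.
have [Gp | Gp] := boolP (p \in G); last by case: (p \in opposite); rewrite ?andbF.
by move: (subsetP sGA p Gp); rewrite in_setD.
Qed.

Lemma even_extension_unique G :
  G \subset points V -> even_on V G -> even_extension (G :&: adjacent) = G.
Proof.
move=> sGV /even_onP evG; set H := G :&: opposite.
have GE : G = (G :&: adjacent) :|: H.
  rewrite -setIUr; apply/esym/setIidPl/(subset_trans sGV)/subsetP=> p Vp.
  by rewrite in_setU in_setD Vp andbT orNb.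
rewrite [RHS]GE; congr (_ :|: _); apply/setP=> b; rewrite in_set in_setI andbC.
have [Ob | //] := boolP (b \in opposite); rewrite ?andbF ?andbT //=.
(* The zero sum over the box of [b] and [a] splits into the adjacent contribution and the membership
   of [b] in [H], which must therefore agree. *)
have := evG b a (subsetP opposite_sub b Ob) Va; rewrite {1}GE box_sumU.
  rewrite [X in _ (+) X]box_sum_opposite ?subsetIr // in_setI Ob andbT.
  by move/negbT; rewrite negb_add => /eqP.
exact: disjointW (subsetIr _ _) (subsetIr _ _) disjoint_adjacent.
Qed.

(** [even_extension] is a bijection from the subsets of [adjacent] to the even sets, with inverse
    the intersection with [adjacent]. *)
Lemma card_even_on :
  #|[set G : {set point} | (G \subset points V) && even_on V G]| =
    2 ^ (\prod_i #|V i| - \prod_i (#|V i| - 1)).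
Proof.
have -> : \prod_i #|V i| - \prod_i (#|V i| - 1) = #|adjacent|.
  rewrite cardsD (setIidPr opposite_sub) !card_points; congr (_ - _).
  apply: eq_bigr => i _; have /pointsP/(_ i) Vai := Va.
  by rewrite (cardsD1 (a i) (V i)) Vai addKn.
rewrite -card_powerset -[RHS](@card_in_imset _ _ even_extension); last first.
  move=> G1 G2; rewrite !inE => sG1 sG2 eqG.
  by rewrite -(even_extension_adjacent sG1) eqG even_extension_adjacent.
apply: eq_card => G; rewrite inE; apply/andP/imsetP => [[sGV evG] | [F]].
  by exists (G :&: adjacent); rewrite ?even_extension_unique // inE subsetIr.
rewrite inE => sFA ->; split; last exact: even_extension_even.
rewrite subUset (subset_trans sFA (subsetDl _ _)) /=.
by apply/(subset_trans _ opposite_sub)/subsetP=> p; rewrite inE => /andP[].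
Qed.

End BasePoint.

End Boxes.

(** * Edges as transversals of the disjoint classes *)

Section Transversals.
Variables (T : finType) (n : nat) (V : 'I_n -> {set T}).
Hypothesis Vdisj : forall i j : 'I_n, i != j -> [disjoint V i & V j].
Local Notation point := {ffun 'I_n -> T}.
Implicit Types (p b c : point) (G : {set point}) (E : {set {set T}}).

Definition transversal_of p : {set T} := [set p i | i : 'I_n].

Lemma vertex_class i j x : x \in V i -> x \in V j -> i = j.
Proof.
by move=> Vi Vj; apply: contraTeq Vj => /Vdisj/disjointFr->.
Qed.

Lemma mem_transversal_of p i x :
  p \in points V -> x \in V i -> (x \in transversal_of p) = (x == p i).
Proof.
move=> /pointsP Vp Vx; apply/imsetP/eqP => [[j _ xE] | ->]; last by exists i.
by rewrite xE; congr (p _); apply/(vertex_class (Vp j)); rewrite -xE.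
Qed.

Lemma transversal_of_inj : {in points V &, injective transversal_of}.
Proof.
move=> p q Vp Vq eqpq; apply/ffunP=> i; have /pointsP/(_ i) Vpi := Vp.
by apply/eqP; rewrite -(mem_transversal_of Vq Vpi) -eqpq; apply: imset_f.
Qed.

Lemma transversal_ofI p i : p \in points V -> transversal_of p :&: V i = [set p i].
Proof.
move=> Vp; apply/setP=> x; rewrite in_setI in_set1.
have [Vx | Vx] := boolP (x \in V i); first by rewrite andbT (mem_transversal_of Vp Vx).
by rewrite andbF; apply/esym/(contraNF _ Vx) => /eqP->; apply/pointsP.
Qed.

Lemma transversal_of_vertices p : p \in points V -> transversal_of p \subset vertices V.
Proof.
by move=> /pointsP Vp; apply/subsetP=> _ /imsetP[i _ ->]; apply/bigcupP; exists i.
Qed.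

Lemma card_transversal_of p : p \in points V -> #|transversal_of p| = n.
Proof.
move=> /pointsP Vp; rewrite card_imset ?card_ord // => i j eqp.
by apply: vertex_class (Vp i) _; rewrite eqp.
Qed.

Lemma transversal_ofP (e : {set T}) :
    e \subset vertices V -> (forall i, #|e :&: V i| == 1) ->
  exists2 p, p \in points V & e = transversal_of p.
Proof.
move=> /subsetP sev e1.
(* The boolean equality lets [sigW] turn mere existence into a witness, from which the choice
   function [p] is built. *)
have ex i : {x | e :&: V i == [set x]}.
  by apply/sigW; have /cards1P[x ->] := e1 i; exists x.
pose p : point := [ffun i => sval (ex i)].
have pE i : e :&: V i = [set p i] by rewrite ffunE; apply/eqP/(svalP (ex i)).
have pe i : p i \in e :&: V i by rewrite pE set11.
exists p; first by apply/pointsP=> i; have /setIP[] := pe i.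
apply/setP=> x; apply/idP/imsetP => [ex' | [i _ ->]].
  have /bigcupP[i _ Vx] := sev x ex'; exists i => //.
  by apply/set1P; rewrite -pE inE ex'.
by have /setIP[] := pe i.
Qed.

Lemma npartite_transversals E :
  reflect (exists2 G : {set point}, G \subset points V & E = transversal_of @: G)
          (npartite_hypergraph V E).
Proof.
apply: (iffP and3P) => [[/forall_inP unifE _ /forall_inP E1] | [G /subsetP sGV ->]].
  exists [set p in points V | transversal_of p \in E].
    by apply/subsetP=> p; rewrite inE => /andP[].
  apply/setP=> e; apply/idP/imsetP => [Ee | [p]]; last by rewrite inE => /andP[_ ? ->].
  have /andP[sev _] := unifE e Ee.
  have [p Vp eE] := transversal_ofP sev (forallP (E1 e Ee)).
  by exists p; rewrite // inE Vp -eE.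
split.
- apply/forall_inP=> _ /imsetP[p /sGV Vp ->].
  by rewrite transversal_of_vertices // card_transversal_of /=.
- by apply/'forall_forallP => i j; apply/implyP/Vdisj.
- apply/forall_inP=> _ /imsetP[p /sGV Vp ->]; apply/forallP=> i.
  by rewrite transversal_ofI // cards1.
Qed.

(** A transversal lies in [X] exactly when its point lies in the box of [b] and [c], and distinct
    points of [G] give distinct transversals. *)
Lemma odd_card_sub_transversals G (X : {set T}) b c :
    G \subset points V -> (forall i, X :&: V i = [set b i; c i]) ->
    (forall i, b i != c i) ->
  odd #|[set e in transversal_of @: G | e \subset X]| = box_sum G b c.
Proof.
move=> sGV XE bc; rewrite box_sum_odd_card //.
rewrite -(@card_in_imset _ _ transversal_of); last first.
  by move=> p q; rewrite !inE => /andP[Gp _] /andP[Gq _];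
     apply: transversal_of_inj; apply: (subsetP sGV).
have subX p : p \in points V ->
    (transversal_of p \subset X) = (p \in points (fun i => [set b i; c i])).
  move=> /pointsP Vp; apply/subsetP/pointsP => [spX i | pbc x /imsetP[i _ ->]].
    by rewrite -XE inE spX ?imset_f /=.
  by have := pbc i; rewrite -XE => /setIP[].
congr (odd _); apply: eq_card => e; rewrite inE; apply/andP/imsetP.
  case=> /imsetP[p Gp ->] sX; exists p => //.
  by rewrite in_set Gp -subX // (subsetP sGV).
case=> p; rewrite in_set => /andP[Gp pbc] ->; split; first exact: imset_f.
by rewrite subX // (subsetP sGV).
Qed.

Lemma parity_condition_even_on G : G \subset points V ->
  parity_condition V (transversal_of @: G) = even_on V G.
Proof.
move=> sGV; apply/forallP/even_onP => [parG b c Vb Vc | evG X].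
  (* A degenerate box has sum zero; any other one is tested by the set [X] formed by the two
     transversals together. *)
  have [bc | ] := boolP [forall i, b i != c i]; last first.
    by rewrite negb_forall => /existsP[i]; rewrite negbK => /eqP/box_sum_degenerate.
  have XE i : (transversal_of b :|: transversal_of c) :&: V i = [set b i; c i].
    by rewrite setIUl !transversal_ofI.
  rewrite -(odd_card_sub_transversals sGV XE (forallP bc)); apply/negbTE.
  apply: (implyP (parG _)); rewrite subUset !transversal_of_vertices //=.
  by apply/forallP=> i; rewrite XE cards2 (forallP bc).
apply/implyP=> /andP[_ /forallP X2].
(* Conversely, ordering the two elements of [X] in each class yields [b] and [c], which differ
   everywhere. *)
have ex i : {bc | X :&: V i == [set bc.1; bc.2] & bc.1 != bc.2}.
  by apply/sig2W; have /cards2P[x [y [nxy ->]]] := X2 i; exists (x, y).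
pose b : point := [ffun i => (s2val (ex i)).1].
pose c : point := [ffun i => (s2val (ex i)).2].
have XE i : X :&: V i = [set b i; c i] by rewrite !ffunE; apply/eqP/(s2valP (ex i)).
have bc i : b i != c i by rewrite !ffunE (s2valP' (ex i)).
have Xbc i : (b i \in X :&: V i) && (c i \in X :&: V i) by rewrite XE set21 set22.
rewrite (odd_card_sub_transversals sGV XE bc) evG //; apply/pointsP=> i.
  by have /andP[/setIP[]] := Xbc i.
by have /andP[_ /setIP[]] := Xbc i.
Qed.

End Transversals.

Arguments transversal_of {T n} p.

(** * Transfer of the count from even sets of points to edge sets *)

Theorem theorem3p2 (T : finType) (n : nat) (V : 'I_n -> {set T})
    (Vdisj : forall i j : 'I_n, i != j -> [disjoint V i & V j])
    (Vcard : forall i : 'I_n, 2 <= #|V i|) :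
  #|[set E : {set {set T}} | octahedral_system V E]| =
    2 ^ (\prod_(i < n) #|V i| - \prod_(i < n) (#|V i| - 1)).
Proof.
(* The classes are nonempty, which supplies a base point. *)
have ex i : {x | x \in V i} by apply/sigW/card_gt0P/ltnW.
have Va : [ffun i => sval (ex i)] \in points V.
  by apply/pointsP=> i; rewrite ffunE; apply: (svalP (ex i)).
rewrite -(card_even_on Va).
rewrite -[RHS](@card_in_imset _ _
  (fun G : {set {ffun 'I_n -> T}} => transversal_of @: G)).
  apply: eq_card => E; rewrite inE; apply/and3P/imsetP.
    case=> /(npartite_transversals Vdisj)[G sGV ->] _.
    by rewrite parity_condition_even_on // => evG; exists G; rewrite // inE sGV.
  case=> G; rewrite inE => /andP[sGV evG] ->; split.
  - by apply/npartite_transversals=> //; exists G.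
  - exact/forallP.
  - by rewrite parity_condition_even_on.
move=> G1 G2; rewrite !inE => /andP[sG1 _] /andP[sG2 _] eqG.
(* Taking images is injective on sets of points because [transversal_of] is injective on points; by
   symmetry one inclusion suffices. *)
have sub (G H : {set {ffun 'I_n -> T}}) :
    G \subset points V -> H \subset points V ->
    transversal_of @: G = transversal_of @: H -> G \subset H.
  move=> /subsetP sG /subsetP sH eqGH; apply/subsetP=> p Gp.
  have /imsetP[q Hq] : transversal_of p \in transversal_of @: H.
    by rewrite -eqGH imset_f.
  by move/(transversal_of_inj Vdisj (sG p Gp) (sH q Hq)) ->.
apply/eqP; rewrite eqEsubset (sub _ _ sG1 sG2 eqG).
exact: sub _ _ sG2 sG1 (esym eqG).
Qed.
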